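(* For all integers $n\ge0$, the sequence $(u_{ob}(m,n))_{m\in\mathbb{Z}}$ is symmetric and unimodal. Moreover, for all integers $m,n\ge0$, $u_{ob}(m,n)>u_{ob}(m+2,n)$ provided $u_{ob}(m,n)\ne0$.
   Context: $(a;q)_n=\prod_{0\le j<n}(1-aq^j)$, $(a,b;q)_n=(a;q)_n(b;q)_n$. The numbers $u_{ob}(m,n)$ (odd-balanced unimodal sequences of weight $2n+2$ and rank $m$) are defined by $$\sum_{n\ge0}\sum_{m\in\mathbb{Z}}u_{ob}(m,n)z^mq^n=\sum_{n\ge0}\frac{(-zq,-z^{-1}q;q)_nq^n}{(q;q^2)_{n+1}}.$$ A two-sided sequence with finitely many nonzero terms is symmetric if its $m$-th and $(-m)$-th terms agree, and unimodal if, restricted to the smallest interval of indices containing all its nonzero terms, it first weakly increases and then weakly decreases. *)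

(* Defs.v *)
From HB Require Import structures.
From mathcomp Require Import all_boot all_order all_algebra.
From mathcomp Require Import finmap monalg zify.

Set Implicit Arguments.
Unset Strict Implicit.
Unset Printing Implicit Defensive.

Import Order.TTheory GRing.Theory Num.Theory.

Local Open Scope fset_scope.
Local Open Scope ring_scope.

(* Z[z, z^-1], as the group algebra of the additive group int over int: c@_m is
   the coefficient of z^m in c.  The ring structure that monalg puts on
   {malg R[K]} requires K to be a monoid without nontrivial units, which int is
   not, so the product is defined here. *)
Definition laurent : Type := {malg int[int]}.

HB.instance Definition _ := GRing.Zmodule.copy laurent {malg int[int]}.

Definition zpow (k : int) : laurent := << 1 *g k >>.

Definition lmul (f g : laurent) : laurent :=
  \sum_(i <- msupp f) \sum_(j <- msupp g) << f@_i * g@_j *g i + j >>.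

Section LaurentRing.
Implicit Types f g h : laurent.

Lemma lmulw (d1 d2 : {fset int}) f g : msupp f `<=` d1 -> msupp g `<=` d2 ->
  lmul f g = \sum_(i <- d1) \sum_(j <- d2) << f@_i * g@_j *g i + j >>.
Proof.
move=> le1 le2; rewrite /lmul (big_fset_incl _ le1) /=.
  apply/eq_bigr=> i _; apply/big_fset_incl => // k _ /mcoeff_outdom ->.
  by rewrite mulr0 monalgU0.
move=> k _ /mcoeff_outdom fk.
by rewrite big1 => // j _; rewrite fk mul0r monalgU0.
Qed.

Lemma lmulC : commutative lmul.
Proof.
move=> f g; rewrite /lmul exchange_big; apply: eq_bigr => i _.
by apply: eq_bigr => j _; rewrite mulrC addrC.
Qed.

Lemma lmulDl : left_distributive lmul +%R.
Proof.
move=> f g h.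
rewrite (lmulw (msuppD_le f g) (fsubset_refl _)).
rewrite [X in _ = X + _](lmulw (fsubsetUl _ (msupp g)) (fsubset_refl _)).
rewrite [X in _ = _ + X](lmulw (fsubsetUr (msupp f) _) (fsubset_refl _)).
rewrite -big_split /=; apply/eq_bigr=> i _.
rewrite -big_split /=; apply/eq_bigr=> j _.
by rewrite mcoeffD mulrDl monalgUD.
Qed.

Lemma lmul0l : left_zero 0 lmul.
Proof. by move=> f; rewrite /lmul msupp0 big_seq_fset0. Qed.

Lemma lmul_suml f (I : Type) (r : seq I) (F : I -> laurent) :
  lmul (\sum_(i <- r) F i) f = \sum_(i <- r) lmul (F i) f.
Proof.
exact: (big_morph (lmul^~ f) (fun _ _ => lmulDl _ _ _) (lmul0l _)).
Qed.

Lemma lmul_sumr f (I : Type) (r : seq I) (F : I -> laurent) :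
  lmul f (\sum_(i <- r) F i) = \sum_(i <- r) lmul f (F i).
Proof. by rewrite lmulC lmul_suml; apply: eq_bigr => i _; rewrite lmulC. Qed.

Lemma lmulUU (c1 c2 k1 k2 : int) :
  lmul << c1 *g k1 >> << c2 *g k2 >> = << c1 * c2 *g k1 + k2 >>.
Proof. by rewrite (lmulw msuppU_le msuppU_le) !big_seq_fset1 !mcoeffUU. Qed.

Lemma lmulEl f g : lmul f g = \sum_(i <- msupp f) lmul << f@_i *g i >> g.
Proof. by rewrite {1}[f]monalgE lmul_suml. Qed.

Lemma lmulA : associative lmul.
Proof.
move=> f g h; rewrite [f]monalgE.
rewrite (lmul_suml (lmul g h)) (lmul_suml g) (lmul_suml h).
apply: eq_bigr => i _; set u := << _ *g i >>.
rewrite [g]monalgE (lmul_suml h) 2!lmul_sumr (lmul_suml h).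
apply: eq_bigr => j _; set v := << _ *g j >>.
rewrite [h]monalgE.
rewrite (lmul_sumr v) (lmul_sumr u) (lmul_sumr (lmul u v)).
apply: eq_bigr => k _.
by rewrite !lmulUU mulrA addrA.
Qed.

Lemma lmul1l : left_id (zpow 0) lmul.
Proof.
move=> f; rewrite [in RHS](monalgE f) {1}(monalgE f) lmul_sumr.
by apply: eq_bigr => i _; rewrite lmulUU mul1r add0r.
Qed.

Lemma zpow0_neq0 : zpow 0 != 0.
Proof. by rewrite monalgU_eq0. Qed.

End LaurentRing.

HB.instance Definition _ := GRing.Zmodule_isComNzRing.Build laurent
  lmulA lmulC lmul1l lmulDl zpow0_neq0.

Lemma zpow0 : zpow 0 = 1.
Proof. by []. Qed.

Lemma zpowD (i j : int) : zpow (i + j) = zpow i * zpow j.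
Proof. by rewrite [RHS]lmulUU. Qed.

Definition qpoch (A : comNzRingType) (a q : A) (n : nat) : A :=
  \prod_(j < n) (1 - a * q ^+ j).

(* Coefficient of q^n in the power series p / d, for d with constant term 1:
   1 / d is the sum over k of (1 - d)^k, where (1 - d)^k is divisible by q^k. *)
Definition series_div (A : comNzRingType) (p d : {poly A}) (n : nat) : A :=
  (p * \sum_(k < n.+1) (1 - d) ^+ k)`_n.

Lemma coef_mulX_exp (A : comNzRingType) (p e : {poly A}) (k n : nat) :
  e`_0 = 0 -> (n < k)%N -> (p * e ^+ k)`_n = 0.
Proof.
move=> e0; elim: k n => [//|k IH] n ltnk.
rewrite exprS mulrCA coefM big_ord_recl e0 mul0r add0r big1 // => i _.
by rewrite IH ?mulr0 // lift0; case: i => i lti /=; lia.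
Qed.

Lemma series_divE (A : comNzRingType) (p d : {poly A}) (n N : nat) :
  d`_0 = 1 -> (n <= N)%N ->
  series_div p d n = (p * \sum_(k < N.+1) (1 - d) ^+ k)`_n.
Proof.
move=> d0 leN; have e0 : (1 - d)`_0 = 0 by rewrite coefB coef1 d0 subrr.
rewrite /series_div -(subnKC leN) -addSn big_split_ord /= mulrDr coefD.
rewrite [X in _ = _ + X](_ : _ = 0) ?addr0 // mulr_sumr coef_sum big1 // => i _.
by apply: coef_mulX_exp => //; rewrite addSn ltnS leq_addr.
Qed.

Lemma series_divK (A : comNzRingType) (p d : {poly A}) (n : nat) :
  d`_0 = 1 -> \sum_(i < n.+1) d`_i * series_div p d (n - i) = p`_n.
Proof.
move=> d0; have e0 : (1 - d)`_0 = 0 by rewrite coefB coef1 d0 subrr.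
rewrite (eq_bigr (fun i : 'I_n.+1 =>
  d`_i * (p * \sum_(k < n.+1) (1 - d) ^+ k)`_(n - i))); last first.
  by move=> i _; rewrite (series_divE p d0 (leq_subr i n)).
rewrite -coefM mulrCA.
have -> : d * (\sum_(k < n.+1) (1 - d) ^+ k) = 1 - (1 - d) ^+ n.+1.
  by rewrite -[RHS]opprB subrX1 -mulNr opprB subKr.
by rewrite mulrBr mulr1 coefB coef_mulX_exp // subr0.
Qed.

(* The n-th summand of the generating function of u_ob is ob_num n / ob_den n,
   where the polynomial variable 'X is q. *)
Definition ob_num (n : nat) : {poly laurent} :=
  qpoch (- (zpow 1 *: 'X)) 'X n * qpoch (- (zpow (-1) *: 'X)) 'X n * 'X^n.

Definition ob_den (n : nat) : {poly laurent} := qpoch 'X ('X ^+ 2) n.+1.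

(* The k-th summand is divisible by q^k, hence only those with k <= n contribute
   to the coefficient of q^n; see u_obE. *)
Definition u_ob (m : int) (n : nat) : int :=
  (\sum_(k < n.+1) series_div (ob_num k) (ob_den k) n)@_m.

Lemma ob_den0 (n : nat) : (ob_den n)`_0 = 1.
Proof.
rewrite -horner_coef0 /ob_den /qpoch horner_prod big1 // => i _.
by rewrite hornerD hornerN hornerM hornerX mul0r hornerC subr0.
Qed.

Lemma ob_term_eq0 (k n : nat) :
  (n < k)%N -> series_div (ob_num k) (ob_den k) n = 0.
Proof. by move=> ltnk; rewrite /series_div /ob_num mulrAC coefMXn ltnk. Qed.

Lemma u_obE (m : int) (n K : nat) : (n < K)%N ->
  u_ob m n = (\sum_(k < K) series_div (ob_num k) (ob_den k) n)@_m.
Proof.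
move=> ltnK; rewrite /u_ob -(subnKC ltnK) [in RHS]big_split_ord /=.
rewrite [X in (_ + X)@_m]big1 ?addr0 // => i _.
by apply: ob_term_eq0; rewrite addSn ltnS leq_addr.
Qed.

Lemma u_ob_finite (n : nat) :
  exists s : {fset int}, forall m, u_ob m n != 0 -> m \in s.
Proof.
exists (msupp (\sum_(k < n.+1) series_div (ob_num k) (ob_den k) n)) => m.
by rewrite mcoeff_neq0.
Qed.

Definition symmetric_seq (a : int -> int) : Prop := forall m, a m = a (- m).

(* Membership in the smallest interval containing all nonzero terms of a *)
Definition in_span (a : int -> int) (k : int) : Prop :=
  (exists2 i, i <= k & a i != 0) /\ (exists2 j, k <= j & a j != 0).

Definition unimodal_seq (a : int -> int) : Prop :=
  exists p : int,
    (forall i j, in_span a i -> in_span a j -> i <= j -> j <= p -> a i <= a j)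
    /\
    (forall i j, in_span a i -> in_span a j -> p <= i -> i <= j -> a j <= a i).

(* Main.v *)
(** Every summand q^k P_k / (q;q^2)_{k+1}, with P_k the product over 1 <= j <= k of
    F_j = (1 + z q^j)(1 + z^-1 q^j) = 1 + q^(2j) + q^j (z + z^-1), is handled
    separately, using two cones of symmetric Laurent polynomials f.

    - Multiplication by z + z^-1 preserves the condition f_m >= f_(m+2) (m >= 0),
      so the coefficients of P_k satisfy it, and so do those of the summand.
    - Multiplication by 1 + z + z^-1 preserves f_m >= f_(m+1) (m >= 0).  Here F_j
      itself is not in the cone, but
        (1 + q^j) F_j = 1 + q^(3j) + (q^j + q^(2j)) (1 + z + z^-1)
      is, and the factors 1 + q^j are paid for by the denominator:
        (q;q^2)_{k+1} (-q;q)_k = (q^(k+1);q)_{k+1}.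

    For the strict inequality: the coefficient of z^m in P_k vanishes for k < m and
    is divisible by q^(m(m+1)/2), with equality for k = m, where the coefficient of
    z^(m+2) is 0.  Hence u_ob(m, n) = 0 for n < m + m(m+1)/2, while for the other n
    the factor 1 / (1 - q) makes the m-th summand contribute at least 1 to
    u_ob(m, n) - u_ob(m+2, n). *)

Require Import Defs.
From mathcomp Require Import all_boot all_order all_algebra.
From mathcomp Require Import monalg zify ring.

Set Implicit Arguments.
Unset Strict Implicit.
Unset Printing Implicit Defensive.

Import Order.TTheory GRing.Theory Num.Theory.
Local Open Scope ring_scope.

(** * Division of power series by products of factors 1 - q^a *)

Section SeriesDivision.
Variable A : comNzRingType.
Implicit Types p d e c : {poly A}.

Lemma series_div_unique p d e (n : nat) : d`_0 = 1 ->
  (forall i, (i <= n)%N -> (d * e)`_i = p`_i) -> e`_n = series_div p d n.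
Proof.
move=> d0; elim/ltn_ind: n => n IHn de.
have := de n (leqnn n); rewrite -(series_divK p n d0) coefM.
rewrite !big_ord_recl /= d0 !mul1r subn0 => /eqP.
rewrite (eq_bigr (fun i : 'I_n => d`_(bump 0 i) * series_div p d (n - bump 0 i))).
  by move/eqP/addIr.
move=> i _; rewrite -IHn //; first by have := ltn_ord i; rewrite /bump; lia.
by move=> j lej; apply: de; rewrite (leq_trans lej) ?leq_subr.
Qed.

(** Up to degree n the quotient is represented by a polynomial, so identities in [{poly A}] can
    replace power series identities. *)
Lemma series_div_witness p d (n : nat) : d`_0 = 1 ->
  exists2 e, (forall i, (i <= n)%N -> (d * e)`_i = p`_i)
           & forall i, (i <= n)%N -> e`_i = series_div p d i.
Proof.
move=> d0; exists (p * \sum_(k < n.+1) (1 - d) ^+ k) => i lein; last first.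
  by rewrite (series_divE p d0 lein).
rewrite -(series_divK p i d0) coefM; apply: eq_bigr => j _.
by rewrite -series_divE // (leq_trans (leq_subr _ _)).
Qed.

Lemma series_divMr p d c (n : nat) : d`_0 = 1 -> c`_0 = 1 ->
  series_div (p * c) (d * c) n = series_div p d n.
Proof.
move=> d0 c0; have [e de eE] := series_div_witness p n d0; rewrite -eE //.
rewrite -(@series_div_unique _ _ e) //.
  by rewrite coef0M d0 c0 mulr1.
move=> i lein; rewrite mulrAC !coefM; apply: eq_bigr => j _.
by rewrite de // (leq_trans _ lein) // -ltnS.
Qed.

Lemma series_div1 p (n : nat) : series_div p 1 n = p`_n.
Proof.
by rewrite -(@series_div_unique _ _ p) ?coef1 // => i _; rewrite mul1r.
Qed.

Lemma series_div_geomM p d (a n : nat) : d`_0 = 1 -> (0 < a)%N ->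
  series_div p ((1 - 'X^a) * d) n =
  series_div p d n +
  (if (n < a)%N then 0 else series_div p ((1 - 'X^a) * d) (n - a)).
Proof.
move=> d0 a_gt0; set d' := _ * d.
have d'0 : d'`_0 = 1.
  by rewrite coef0M coefB coef1 coefXn d0 (ltn_eqF a_gt0) subr0 mul1r.
have [e de eE] := series_div_witness p n d'0.
rewrite -eE // -(@series_div_unique _ _ ((1 - 'X^a) * e)) //; last first.
  by move=> i lein; rewrite -de // mulrA [d * _]mulrC.
rewrite mulrBl mul1r coefB coefXnM; case: ltnP => // lean.
  by rewrite subr0 addr0.
by rewrite -eE ?leq_subr // subrK.
Qed.

Lemma geom_prod0 (s : seq nat) : all (leq 1) s ->
  (\prod_(a <- s) (1 - 'X^a) : {poly A})`_0 = 1.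
Proof.
elim: s => [|a s IHs] /=; first by rewrite big_nil coef1.
case/andP=> a_gt0 s_gt0; rewrite big_cons coef0M IHs // coefB coef1 coefXn.
by rewrite (ltn_eqF a_gt0) subr0 mul1r.
Qed.

(** Dividing by 1 - q^a only ever adds coefficients of lower degree. [Q] depends on the degree so
    that it can also express vanishing below a threshold or a condition at a single degree. *)
Lemma series_div_geom_ind (Q : nat -> A -> Prop) p (s : seq nat) :
    (forall i j x y, (j <= i)%N -> Q i x -> Q j y -> Q i (x + y)) ->
    all (leq 1) s -> (forall i, Q i p`_i) ->
  forall n, Q n (series_div p (\prod_(a <- s) (1 - 'X^a)) n).
Proof.
move=> QD; elim: s => [|a s IHs] /= s_gt0 Qp n.
  by rewrite big_nil series_div1.
case/andP: s_gt0 => a_gt0 s_gt0; rewrite big_cons.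
elim/ltn_ind: n => n IHn; rewrite series_div_geomM ?geom_prod0 //.
case: ltnP => lean; first by rewrite addr0; apply: IHs.
by apply: (QD _ (n - a)%N); rewrite ?leq_subr //; [apply: IHs|apply: IHn; lia].
Qed.

End SeriesDivision.

(** * Coefficients of Laurent polynomials and the factors F_j *)

Lemma lcoef_sum (I : Type) (r : seq I) (P : pred I) (F : I -> laurent) (m : int) :
  (\sum_(i <- r | P i) F i)@_m = \sum_(i <- r | P i) (F i)@_m.
Proof.
rewrite (@big_morph _ _ (fun f : laurent => f@_m) 0 +%R 0 +%R) //.
  by move=> f g; rewrite mcoeffD.
by rewrite mcoeff0.
Qed.

Lemma lcoef_zpowM (k m : int) (f : laurent) : (zpow k * f)@_m = f@_(m - k).
Proof.
rewrite [zpow k * f]mulrC [f * _]lmulEl {3}(monalgE f) lcoef_sum raddf_sum.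
apply: eq_bigr => i _.
by rewrite lmulUU /= !mcoeffU mulr1 [i == _]eq_sym subr_eq eq_sym.
Qed.

Lemma lcoef1 (m : int) : (1 : laurent)@_m = (m == 0)%:R.
Proof. by rewrite mcoeffU eq_sym. Qed.

Definition zsym : laurent := zpow 1 + zpow (-1).

Lemma lcoef_zsymM (m : int) (f : laurent) :
  (zsym * f)@_m = f@_(m - 1) + f@_(m + 1).
Proof. by rewrite mulrDl mcoeffD !lcoef_zpowM opprK. Qed.

Definition ob_factor (j : nat) : {poly laurent} :=
  1 + 'X^(j.*2) + zsym *: 'X^j.

Definition ob_prod (k : nat) : {poly laurent} := \prod_(j < k) ob_factor j.+1.

Lemma ob_numE (k : nat) : ob_num k = ob_prod k * 'X^k.
Proof.
rewrite /ob_num /qpoch -big_split; congr (_ * _); apply: eq_bigr => j _ /=.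
rewrite /ob_factor !mulNr !opprK -!scalerAl -exprS -addnn exprD scalerDl.
rewrite mulrDl mul1r mulrDr mulr1 -scalerAl -scalerAr scalerA -zpowD subrr.
by rewrite scale1r; ring.
Qed.

Lemma ob_denE (k : nat) :
  ob_den k = \prod_(a <- [seq i.*2.+1 | i <- iota 0 k.+1]) (1 - 'X^a).
Proof.
rewrite big_map /ob_den /qpoch.
rewrite -(big_mkord xpredT (fun j => 1 - 'X * 'X ^+ 2 ^+ j)) /index_iota subn0.
by apply: eq_bigr => j _; rewrite -exprM -exprS mul2n.
Qed.

Lemma coef_ob_factorM (j i : nat) (p : {poly laurent}) :
  (ob_factor j * p)`_i =
  p`_i + (if (i < j.*2)%N then 0 else p`_(i - j.*2))
  + zsym * (if (i < j)%N then 0 else p`_(i - j)).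
Proof. by rewrite /ob_factor 2!mulrDl mul1r !coefD -scalerAl coefZ !coefXnM. Qed.

(** * The two cones, for [s = 2] and [s = 1] *)

Definition symm_drop (s : nat) (f : laurent) : Prop :=
  (forall m, f@_m = f@_(- m)) /\ (forall m : nat, f@_(m + s)%N%:Z <= f@_m%:Z).

Section SymmDrop.
Variable s : nat.
Implicit Types f g : laurent.
Implicit Types p : {poly laurent}.

Lemma symm_drop0 : symm_drop s 0.
Proof. by split=> m; rewrite !mcoeff0. Qed.

Lemma symm_dropD f g : symm_drop s f -> symm_drop s g -> symm_drop s (f + g).
Proof.
move=> [fN fs] [gN gs]; split=> m; rewrite !mcoeffD; first by rewrite fN gN.
exact: lerD.
Qed.

Lemma symm_drop1 : symm_drop s 1.
Proof.
split=> m; rewrite !lcoef1; first by rewrite oppr_eq0.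
by rewrite ler_nat; case: m => [|m] //; case: eqP.
Qed.

Lemma symm_drop_coefXnM p (j : nat) :
  (forall i, symm_drop s p`_i) -> forall i, symm_drop s ('X^j * p)`_i.
Proof. by move=> ps i; rewrite coefXnM; case: ifP => // _; apply: symm_drop0. Qed.

End SymmDrop.

Lemma lcoef_zsymM_sym f : (forall m, f@_m = f@_(- m)) ->
  forall m, (zsym * f)@_m = (zsym * f)@_(- m).
Proof.
move=> fN m; rewrite !lcoef_zsymM addrC [f@_(m + 1)]fN [f@_(m - 1)]fN.
by congr (f@__ + f@__); lia.
Qed.

Lemma symm_drop2_zsymM f : symm_drop 2 f -> symm_drop 2 (zsym * f).
Proof.
move=> [fN fs]; split=> [|m]; first exact: lcoef_zsymM_sym.
rewrite !lcoef_zsymM.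
have -> : (m + 2)%N%:Z - 1 = m.+1 by lia.
have -> : (m + 2)%N%:Z + 1 = (m.+1 + 2)%N by lia.
have -> : m%:Z + 1 = m.+1 by lia.
(* Cancelling f_(m+1) leaves f_(m+3) <= f_(m-1): two drops, or a single one for m = 0, since f_(-1)
   = f_1. *)
rewrite addrC lerD2r; case: m => [|m]; first by rewrite sub0r -fN fs.
have -> : m.+1%:Z - 1 = m by lia.
by rewrite (le_trans (fs _)) // -addn2 fs.
Qed.

Lemma symm_drop1_zsymM f : symm_drop 1 f -> symm_drop 1 (f + zsym * f).
Proof.
move=> [fN fs]; split=> m.
  by rewrite !mcoeffD fN; congr (_ + _); apply: lcoef_zsymM_sym.
rewrite !mcoeffD !lcoef_zsymM.
have -> : (m + 1)%N%:Z - 1 = m by lia.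
have -> : (m + 1)%N%:Z + 1 = (m.+1 + 1)%N by lia.
have -> : m%:Z + 1 = (m + 1)%N by lia.
(* What remains is f_(m+2) <= f_(m-1): three drops, or one for m = 0 by symmetry. *)
rewrite [X in X <= _]addrC -addrA lerD2l lerD2r.
case: m => [|m]; first by rewrite sub0r -fN fs.
have -> : m.+1%:Z - 1 = m by lia.
by rewrite (le_trans (fs _)) // -addn1 (le_trans (fs _)) // -addn1 fs.
Qed.

Lemma symm_drop_sum s (I : Type) (r : seq I) (F : I -> laurent) :
  (forall i, symm_drop s (F i)) -> symm_drop s (\sum_(i <- r) F i).
Proof.
move=> Fs; apply: big_ind => //; [exact: symm_drop0|exact: symm_dropD].
Qed.

(** * Membership of the summands in both cones *)

Lemma symm_drop2_ob_prod (k i : nat) : symm_drop 2 (ob_prod k)`_i.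
Proof.
rewrite /ob_prod; elim: k => [|k IHk] in i *.
  rewrite big_ord0 coef1; case: (i == 0%N); [exact: symm_drop1|exact: symm_drop0].
rewrite big_ord_recr /= mulrC coef_ob_factorM.
apply: symm_dropD; first apply: symm_dropD => //.
  by case: ifP => // _; apply: symm_drop0.
by case: ifP => _; rewrite ?mulr0; [apply: symm_drop0|apply: symm_drop2_zsymM].
Qed.

Lemma symm_drop2_ob_term (k n : nat) :
  symm_drop 2 (series_div (ob_num k) (ob_den k) n).
Proof.
rewrite ob_denE; apply: (@series_div_geom_ind _ (fun=> symm_drop 2)).
- by move=> *; apply: symm_dropD.
- by apply/allP => a /mapP[i _ ->].
- rewrite ob_numE mulrC; apply: symm_drop_coefXnM => i.
  exact: symm_drop2_ob_prod.
Qed.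

(** This is (-q;q)_k. *)
Definition qpoch_plus (k : nat) : {poly laurent} := \prod_(j < k) (1 + 'X^(j.+1)).

Lemma qpoch_plus0 (k : nat) : (qpoch_plus k)`_0 = 1.
Proof.
elim: k => [|k IHk]; rewrite /qpoch_plus ?big_ord0 ?coef1 // big_ord_recr.
by rewrite coef0M IHk coefD coef1 coefXn addr0 mul1r.
Qed.

(** In the induction, the new 1 + q^(k+1) turns the lowest factor 1 - q^(k+1) into 1 - q^(2k+2), and
    [ob_den] supplies 1 - q^(2k+3). *)
Lemma ob_den_plus (k : nat) :
  ob_den k * qpoch_plus k = \prod_(a <- iota k.+1 k.+1) (1 - 'X^a).
Proof.
elim: k => [|k IHk].
  by rewrite /ob_den /qpoch /qpoch_plus big_ord_recl !big_ord0 big_seq1 !mulr1.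
have -> : ob_den k.+1 = ob_den k * (1 - 'X^(k.+1.*2.+1)).
  by rewrite /ob_den /qpoch big_ord_recr /= -exprM -exprS mul2n.
have -> : qpoch_plus k.+1 = qpoch_plus k * (1 + 'X^(k.+1)).
  by rewrite /qpoch_plus big_ord_recr.
have -> : iota k.+2 k.+2 = iota k.+2 k ++ [:: k.+1.*2; k.+1.*2.+1].
  by rewrite -{2}(addn2 k) iotaD (_ : k.+2 + k = k.+1.*2)%N //; lia.
rewrite mulrACA {}IHk big_cat /= !big_cons big_nil -addnn exprD mulr1.
ring.
Qed.

(** The grouping uses only multiplication by powers of q and p + (z + z^-1) p, which both keep the
    coefficients in the second cone. *)
Lemma ob_factor_plusM (j : nat) (p : {poly laurent}) :
  ob_factor j * (1 + 'X^j) * p =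
  p + 'X^(j * 3) * p + 'X^j * (p + zsym *: p) + 'X^(j * 2) * (p + zsym *: p).
Proof.
rewrite /ob_factor -muln2 !exprM -!mul_polyC.
by move: ('X^j) (zsym%:P) => x z; ring.
Qed.

Lemma symm_drop1_ob_prod (k i : nat) :
  symm_drop 1 (ob_prod k * qpoch_plus k)`_i.
Proof.
elim: k => [|k IHk] in i *.
  rewrite /ob_prod /qpoch_plus !big_ord0 mulr1 coef1.
  by case: (i == 0%N); [exact: symm_drop1|exact: symm_drop0].
rewrite /ob_prod /qpoch_plus big_ord_recr /= [X in _ * X]big_ord_recr /=.
rewrite mulrACA mulrC ob_factor_plusM !coefD.
have IHz l : symm_drop 1
    (ob_prod k * qpoch_plus k + zsym *: (ob_prod k * qpoch_plus k))`_l.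
  by rewrite coefD coefZ; apply: symm_drop1_zsymM.
by do 3?apply: symm_dropD => //; apply: symm_drop_coefXnM.
Qed.

Lemma symm_drop1_ob_term (k n : nat) :
  symm_drop 1 (series_div (ob_num k) (ob_den k) n).
Proof.
rewrite -(series_divMr _ _ (ob_den0 k) (qpoch_plus0 k)) ob_den_plus.
apply: (@series_div_geom_ind _ (fun=> symm_drop 1)).
- by move=> *; apply: symm_dropD.
- by apply/allP => a; rewrite mem_iota => /andP[/(leq_ltn_trans _)->].
- rewrite ob_numE mulrAC mulrC; apply: symm_drop_coefXnM => i.
  exact: symm_drop1_ob_prod.
Qed.

(** * Lowest powers of q, and strictness *)

Lemma lcoef_ob_prod_eq0 (k m i : nat) : (k < m)%N || (i < 'C(m.+1, 2))%N ->
  ((ob_prod k)`_i)@_m%:Z = 0.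
Proof.
elim: k => [|k IHk] in m i *.
  rewrite /ob_prod big_ord0 coef1; case: m i => [|m] [|i] //= _.
    by rewrite lcoef1.
  by rewrite mcoeff0.
rewrite /ob_prod big_ord_recr /= mulrC coef_ob_factorM !mcoeffD lcoef_zsymM.
case: m => [|m]; first by rewrite bin_small.
have -> : m.+1%:Z - 1 = m by lia.
have -> : m.+1%:Z + 1 = m.+2 by lia.
have binE n : 'C(n.+2, 2) = ('C(n.+1, 2) + n.+1)%N by rewrite binS bin1.
(* The two bounds support each other: taking z from F_(k+1) costs q^(k+1), which covers the
   increment m + 1 of the binomial if m <= k; if m > k, the degree of P_k in z is too small. *)
rewrite !binE => km; rewrite IHk; last by rewrite binE; lia.
case: ifP => lti; case: ifP => ltj; rewrite ?mcoeff0 ?IHk // ?binE; lia.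
Qed.

Lemma lcoef_ob_prod_top (k : nat) : ((ob_prod k)`_'C(k.+1, 2))@_k%:Z = 1.
Proof.
elim: k => [|k IHk]; first by rewrite /ob_prod big_ord0 coef1 lcoef1.
rewrite {1}/ob_prod big_ord_recr /= mulrC coef_ob_factorM !mcoeffD lcoef_zsymM.
have -> : k.+1%:Z - 1 = k by lia.
have -> : k.+1%:Z + 1 = k.+2 by lia.
rewrite binS bin1 [(_ < k.+1)%N]ltnNge leq_addl addnK IHk /=.
rewrite !lcoef_ob_prod_eq0 ?leqnn ?leqnSn // addr0 add0r.
by case: ifP => _; rewrite ?mcoeff0 ?lcoef_ob_prod_eq0 ?leqnn.
Qed.


Lemma lcoef_ob_term_eq0 (k m n : nat) : (n < m + 'C(m.+1, 2))%N ->
  (series_div (ob_num k) (ob_den k) n)@_m%:Z = 0.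
Proof.
rewrite ob_denE.
apply: (@series_div_geom_ind _
  (fun i (f : laurent) => (i < m + 'C(m.+1, 2))%N -> f@_m%:Z = 0)).
- by move=> i j x y leji xi yj lti; rewrite mcoeffD xi ?yj ?addr0 //; lia.
- by apply/allP => a /mapP[i _ ->].
(* Either k < m and z^m does not occur in P_k, or the prefactor q^k accounts for the additional
   m. *)
- move=> i lti; rewrite ob_numE coefMXn; case: ifP; rewrite ?mcoeff0 // => ltik.
  by apply: lcoef_ob_prod_eq0; lia.
Qed.

Lemma lcoef_ob_term_top (m n : nat) : (m + 'C(m.+1, 2) <= n)%N ->
  (series_div (ob_num m) (ob_den m) n)@_(m + 2)%N%:Z
    < (series_div (ob_num m) (ob_den m) n)@_m%:Z.
Proof.
set N := (m + _)%N => leNn.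
(* The denominator without its factor 1 - q, which is kept for the final induction on n. *)
pose d : {poly laurent} := \prod_(a <- [seq i.*2.+1 | i <- iota 1 m]) (1 - 'X^a).
have d0 : d`_0 = 1 by apply: geom_prod0; apply/allP => a /mapP[i _ ->].
(* The strict drop is claimed only at the lowest degree N; the weak drop is carried along for the
   terms added to it. *)
have v i : symm_drop 2 (series_div (ob_num m) d i) /\
    (i = N -> (series_div (ob_num m) d i)@_(m + 2)%N%:Z
              < (series_div (ob_num m) d i)@_m%:Z).
  apply: (@series_div_geom_ind _ (fun i (f : laurent) => symm_drop 2 f /\
    (i = N -> f@_(m + 2)%N%:Z < f@_m%:Z))).
  - move=> j l x y _ [xs xN] [ys _]; split=> [|jN]; first exact: symm_dropD.
    by rewrite !mcoeffD ltr_leD ?xN //; case: ys.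
  - by apply/allP => a /mapP[j _ ->].
  - move=> j; split=> [|->].
      rewrite ob_numE mulrC; apply: symm_drop_coefXnM => l.
      exact: symm_drop2_ob_prod.
    rewrite ob_numE coefMXn ltnNge leq_addr addKn /= lcoef_ob_prod_top.
    by rewrite lcoef_ob_prod_eq0 // addn2 ltnS leqnSn.
have dE : ob_den m = (1 - 'X^1) * d by rewrite ob_denE big_cons.
elim: n leNn => [|n IHn] leNn.
  rewrite dE series_div_geomM // addr0.
  by have [_ ->] := v 0%N; last by move: leNn; rewrite leqn0 => /eqP.
(* Division by 1 - q forms partial sums, so the strict drop entering at degree N persists in all
   higher degrees. *)
rewrite dE series_div_geomM // -dE subn1 /= !mcoeffD.
have [[_ vs] vN] := v n.+1.
move: leNn; rewrite leq_eqVlt => /predU1P[eqN|ltN].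
  by rewrite ltr_leD ?vN //; case: (symm_drop2_ob_term m n).
by rewrite ler_ltD ?vs ?IHn.
Qed.

(** * From the summands to u_ob *)

Lemma symm_drop1_nonincreasing (f : laurent) (i j : int) :
  symm_drop 1 f -> 0 <= i -> i <= j -> f@_j <= f@_i.
Proof.
move=> [_ fs]; case: i j => [i|//] [j|//] _; rewrite lez_nat.
move/subnK <-; elim: (j - i)%N => [//|l IHl].
by rewrite addSn -addn1 (le_trans (fs _)).
Qed.

Theorem theorem4p10 :
  (forall n : nat,
     symmetric_seq (fun m : int => u_ob m n) /\
     unimodal_seq (fun m : int => u_ob m n)) /\
  (forall m n : nat,
     u_ob m%:Z n != 0 -> u_ob (m%:Z + 2) n < u_ob m%:Z n).
Proof.
split=> [n|m n].
  have u1 := @symm_drop_sum 1 _ (index_enum _) _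
    (fun k : 'I_n.+1 => symm_drop1_ob_term k n).
  have uN : symmetric_seq (fun m => u_ob m n) by case: u1.
  (* The peak is at 0, and symmetry reduces the increasing half to the decreasing one. *)
  split=> //; exists 0; split=> i j _ _ => [lij j0|i0 lij]; last first.
    exact: symm_drop1_nonincreasing.
  by rewrite uN [leRHS]uN; apply: symm_drop1_nonincreasing => //; lia.
have -> : m%:Z + 2 = (m + 2)%N by [].
case: (ltnP n (m + 'C(m.+1, 2))) => [ltn|len _].
  rewrite /u_ob lcoef_sum big1 ?eqxx // => k _.
  exact: lcoef_ob_term_eq0.
have lmn : (m < n.+1)%N by rewrite ltnS (leq_trans _ len) ?leq_addr.
(* The m-th summand drops strictly, all others weakly. *)
rewrite /u_ob !lcoef_sum (bigD1 (Ordinal lmn)) //=.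
rewrite [ltRHS](bigD1 (Ordinal lmn)) //=.
apply: ltr_leD; first exact: lcoef_ob_term_top.
by apply: ler_sum => k _; case: (symm_drop2_ob_term k n).
Qed.
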